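(* Let $M>0$ be real and let $(a_n)_{n\ge1}$ be a sequence of real numbers such that the series $\sum_n a_n$ does not oscillate, i.e. it converges in $\mathbb{R}$, diverges to $+\infty$, or diverges to $-\infty$. Then the projection $f\left(\sum_n a_n\right)$ of the series converges in $\mathbf{B}_M$; that is, the sequence $\left(f\left(\sum_{n=1}^k a_n\right)\right)_{k\ge1}$ converges to $f\left(\sum_{n=1}^\infty a_n\right)\in[0,M]$, where $\sum_{n=1}^\infty a_n\in[-\infty,\infty]$ is the limit of the partial sums.
   Context: $\mathbf{B}_M$ has underlying set $B_M=[0,M]$ with the usual order and the topology induced from $\mathbb{R}$. The generator $f:[-\infty,\infty]\to[0,M]$ is the bijection given by $f(x)=M\left(\frac{\arctan(x)}{\pi}+\frac12\right)$ for $x\in\mathbb{R}$, $f(\infty)=M$, $f(-\infty)=0$. *)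

(* Defs.v *)
From HB Require Import structures.
From mathcomp Require Import all_boot all_order all_algebra.
From mathcomp Require Import all_classical all_reals all_analysis.
From mathcomp Require Import lra.
Set Implicit Arguments.
Unset Strict Implicit.
Unset Printing Implicit Defensive.
Import Order.TTheory GRing.Theory Num.Theory.
Import numFieldNormedType.Exports.
Local Open Scope classical_set_scope.
Local Open Scope ring_scope.

(* As a [set_type], this carries the initial topology of the inclusion in R. *)
Definition B (R : realType) (M : R) : topologicalType :=
  set_type [set` `[0, M]].

Definition gen_val (R : realType) (M : R) (x : \bar R) : R :=
  match x with
  | r%:E => M * (atan r / pi + 2^-1)
  | +oo%E => M
  | -oo%E => 0
  end.

Lemma gen_val_in (R : realType) (M : R) (M0 : 0 < M) (x : \bar R) :
  gen_val M x \in [set` `[0, M]].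
Proof.
rewrite inE /= in_itv /=; case: x => [r| |] /=; last 2 first.
- by rewrite lexx ltW.
- by rewrite lexx ltW.
have pi0 : 0 < pi :> R := pi_gt0 R.
have lo : - 2^-1 <= atan r / pi.
  by rewrite ler_pdivlMr //; have := atan_gtNpi2 r; lra.
have hi : atan r / pi <= 2^-1.
  by rewrite ler_pdivrMr //; have := atan_ltpi2 r; lra.
have [l0 l1] : 0 <= atan r / pi + 2^-1 /\ atan r / pi + 2^-1 <= 1 by lra.
by rewrite mulr_ge0 ?(ltW M0) //= ler_piMr // ltW.
Qed.

Definition gen (R : realType) (M : R) (M0 : 0 < M) (x : \bar R) : B M :=
  SigSub (gen_val_in M0 x).

(* Terms are indexed from 1; the value [a 0] is never used. *)
Definition partial_sum (R : realType) (a : nat -> R) (k : nat) : R :=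
  \sum_(1 <= n < k.+1) a n.

Definition non_oscillating (R : realType) (a : nat -> R) : Prop :=
  [\/ cvg (partial_sum a @ \oo),
      partial_sum a @ \oo --> +oo |
      partial_sum a @ \oo --> -oo].

(* Main.v *)
Require Import Defs.
From mathcomp Require Import all_boot all_order all_algebra.
From mathcomp Require Import all_classical all_reals all_analysis.
From mathcomp Require Import lra.
Import Order.TTheory GRing.Theory Num.Theory.
Import numFieldNormedType.Exports.
Local Open Scope classical_set_scope.
Local Open Scope ring_scope.

(** The generator is continuous on the extended line: arctan is continuous and tends to [pi / 2] and
    [- (pi / 2)] at the two ends, so the values [M] and [0] chosen at infinity are the limits there
    ([cvg_gen_val]). Convergence in [B M] is convergence of the underlying reals ([cvg_gen]). It
    remains to see that the partial sums tend to the series in [\bar R] ([cvg_partial_sum]). *)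

(* Unlike the library's [cvg_image], this does not ask [f] to be surjective. *)
Lemma cvg_initial_topology (W : choiceType) (T : topologicalType) (f : W -> T)
    (I : Type) (F : set_system I) (u : I -> W) (s : W) :
  Filter F -> f (u i) @[i --> F] --> f s ->
  u @ F --> (s : initial_topology f).
Proof.
move=> FF fus A [_ [[V Vop <-] Vfs VA]].
have /fus : nbhs (f s) V by rewrite nbhsE; exists V.
by apply: (@filterS _ F) => i; exact: VA.
Qed.

Lemma cvgNy_atan (R : realType) : (@atan R) x @[x --> -oo] --> - (pi / 2).
Proof.
apply/cvgNy_compNP.
under eq_fun do rewrite /= atanN.
exact: cvgN (@cvgy_atan R).
Qed.

Lemma cvg_gen_val (R : realType) (M : R) (I : Type) (F : set_system I)
    (u : I -> R) (l : \bar R) :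
  Filter F -> (u i)%:E @[i --> F] --> l ->
  gen_val M (u i)%:E @[i --> F] --> gen_val M l.
Proof.
move=> FF ul.
have pi0 : pi != 0 :> R by rewrite gt_eqF// pi_gt0.
(* On finite arguments the generator is an affine function of arctan, so each case only needs the
   limit [c] of arctan. *)
have scale (c : R) : atan (u i) @[i --> F] --> c ->
    gen_val M (u i)%:E @[i --> F] --> M * (c / pi + 2^-1).
  by move=> uc; apply: cvgMr; apply: cvgD; [exact: cvgMl|exact: cvg_cst].
case: l ul => [r| |] ul.
- apply: scale; apply: (continuous_cvg _ (@continuous_atan R r)).
  by move/fine_cvg : ul.
(* The value at infinity is put in the form required by [scale], with [c = pi / 2]. *)
- have -> : gen_val M +oo%E = M * (pi / 2 / pi + 2^-1).
    by rewrite mulrAC divff//=; lra.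
  by apply: scale; apply: cvg_comp (@cvgy_atan R); exact/cvgeryP.
- have -> : gen_val M -oo%E = M * (- (pi / 2) / pi + 2^-1).
    by rewrite mulNr mulrAC divff//=; lra.
  by apply: scale; apply: cvg_comp (@cvgNy_atan R); exact/cvgerNyP.
Qed.

Lemma cvg_gen (R : realType) (M : R) (M0 : 0 < M) (I : Type)
    (F : set_system I) (u : I -> R) (l : \bar R) :
  Filter F -> (u i)%:E @[i --> F] --> l ->
  gen M0 (u i)%:E @[i --> F] --> gen M0 l.
Proof.
move=> FF ul.
apply: (@cvg_initial_topology (B M) R set_val) => //.
by rewrite set_valE /=; exact: cvg_gen_val.
Qed.

Lemma cvg_partial_sum (R : realType) (a : nat -> R) :
  non_oscillating a ->
  (partial_sum a k)%:E @[k --> \oo] --> (\sum_(1 <= n <oo) (a n)%:E)%E.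
Proof.
move=> ha.
(* The infinite sum is defined as a [lim], which is meaningful only once some limit in [\bar R] is
   known to exist. *)
have : cvg ((partial_sum a k)%:E @[k --> \oo]).
  case: ha => [/cvg_ex[l al]|ay|aNy]; apply/cvg_ex.
  - by exists l%:E; apply: cvg_EFin; [exact: nearW|exact: al].
  - by exists +oo%E; exact/cvgeryP.
  - by exists -oo%E; exact/cvgerNyP.
move=> /cvg_ex[l al].
suff -> : (\sum_(1 <= n <oo) (a n)%:E)%E = l by [].
(* The infinite sum is the limit of sums over [n < k], whereas [partial_sum a k] includes the term
   [a k]; hence the shift by one. *)
apply/cvg_lim => //; rewrite -cvg_shiftS /=.
by under eq_fun do rewrite sumEFin.
Qed.

Theorem mainTheorem6 (R : realType) (M : R) (M0 : 0 < M) (a : nat -> R)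
    (ha : non_oscillating a) :
  (fun k : nat => gen M0 (partial_sum a k)%:E) @ \oo
    --> gen M0 (\sum_(1 <= n <oo) (a n)%:E)%E.
Proof. exact: cvg_gen (cvg_partial_sum _ _ ha). Qed.
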